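(* Let $X$ be a biquandle with a distinguished element $x_0$, let $R$ be a commutative ring with unity, and let $\beta=(A,B)$ be an $X$-bracket with values in $R$. For an $X$-coloring $f$ of an oriented link diagram, let $$Z_\beta(f)=\left(\prod_{\tau^+}A_{x_\tau,y_\tau}A_{x_0,x_0}^{-1}\right)\left(\prod_{\tau^-}B_{x_\tau,y_\tau}^{-1}B_{x_0,x_0}\right)\cdot G\;\in\;R^\times/G,$$ where $\tau^+$ (respectively $\tau^-$) ranges over the positive (respectively negative) crossings. Then $Z_\beta(f)$ is a biquandle 2-cocycle invariant of $X$-colored links $f$: there is a biquandle 2-cocycle $\phi:X\times X\to R^\times/G$ such that for every $X$-coloring $f$ of every oriented link diagram $$Z_\beta(f)=\prod_{\tau}\phi(x_\tau,y_\tau)^{\epsilon(\tau)},$$ where $\tau$ ranges over all crossings and $\epsilon(\tau)\in\{+1,-1\}$ is the sign of $\tau$; and $Z_\beta(f)$ is unchanged when Reidemeister moves are applied to the diagram and the $X$-coloring is updated correspondingly.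
   Context: **Biquandles.** A biquandle is a set $X$ with two binary operations $\underline{\rhd},\overline{\rhd}$ such that for all $x,y,z\in X$: (i) $x\,\underline{\rhd}\,x=x\,\overline{\rhd}\,x$; (ii) the maps $\alpha_y(x)=x\,\overline{\rhd}\,y$, $\beta_y(x)=x\,\underline{\rhd}\,y$ and $S(x,y)=(y\,\overline{\rhd}\,x,\;x\,\underline{\rhd}\,y)$ are invertible; (iii) $(x\underline{\rhd}y)\underline{\rhd}(z\underline{\rhd}y)=(x\underline{\rhd}z)\underline{\rhd}(y\overline{\rhd}z)$, $(x\underline{\rhd}y)\overline{\rhd}(z\underline{\rhd}y)=(x\overline{\rhd}z)\underline{\rhd}(y\overline{\rhd}z)$, $(x\overline{\rhd}y)\overline{\rhd}(z\overline{\rhd}y)=(x\overline{\rhd}z)\overline{\rhd}(y\underline{\rhd}z)$. **Colorings.** An $X$-coloring of an oriented link diagram assigns an element of $X$ to each semiarc (edge between consecutive crossing points, counting over- and under-passages) so that the following holds at each crossing $\tau$. Draw $\tau$ with both strands pointing downwards; let $x_\tau$ be the color of the left semiarc belonging to the under-strand and $y_\tau$ the color of the left semiarc belonging to the over-strand. Then the right semiarc of the under-strand has color $x_\tau\,\underline{\rhd}\,y_\tau$ and the right semiarc of the over-strand has color $y_\tau\,\overline{\rhd}\,x_\tau$. (At a positive crossing the left under-semiarc is at the top left and the left over-semiarc at the bottom left; at a negative crossing these positions are exchanged.) When a Reidemeister move is performed on a colored diagram, there is a unique $X$-coloring of the new diagram agreeing with the old one outside the disc of the move; this is the corresponding update of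 the coloring. **Biquandle brackets.** An $X$-bracket with values in a commutative unital ring $R$ is a pair of maps $A,B:X\times X\to R^\times$ (written $A_{x,y},B_{x,y}$) together with $\delta\in R$, $w\in R^\times$ such that for all $x,y,z\in X$: (i) $w=-A_{x,x}^2B_{x,x}^{-1}$; (ii) $\delta=-A_{x,y}B_{x,y}^{-1}-A_{x,y}^{-1}B_{x,y}$; (iii) $$A_{x,y}A_{y,z}A_{x\underline{\rhd}y,z\overline{\rhd}y}=A_{x,z}A_{y\overline{\rhd}x,z\overline{\rhd}x}A_{x\underline{\rhd}z,y\underline{\rhd}z},$$ $$A_{x,y}B_{y,z}B_{x\underline{\rhd}y,z\overline{\rhd}y}=B_{x,z}B_{y\overline{\rhd}x,z\overline{\rhd}x}A_{x\underline{\rhd}z,y\underline{\rhd}z},$$ $$B_{x,y}A_{y,z}B_{x\underline{\rhd}y,z\overline{\rhd}y}=B_{x,z}A_{y\overline{\rhd}x,z\overline{\rhd}x}B_{x\underline{\rhd}z,y\underline{\rhd}z},$$ $$A_{x,y}A_{y,z}B_{x\underline{\rhd}y,z\overline{\rhd}y}=A_{x,z}B_{y\overline{\rhd}x,z\overline{\rhd}x}A_{x\underline{\rhd}z,y\underline{\rhd}z}+A_{x,z}A_{y\overline{\rhd}x,z\overline{\rhd}x}B_{x\underline{\rhd}z,y\underline{\rhd}z}+\delta A_{x,z}B_{y\overline{\rhd}x,z\overline{\rhd}x}B_{x\underline{\rhd}z,y\underline{\rhd}z}+B_{x,z}B_{y\overline{\rhd}x,z\overline{\rhd}x}B_{x\underline{\rhd}z,y\underline{\rhd}z},$$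 $$B_{x,z}A_{y\overline{\rhd}x,z\overline{\rhd}x}A_{x\underline{\rhd}z,y\underline{\rhd}z}=B_{x,y}A_{y,z}A_{x\underline{\rhd}y,z\overline{\rhd}y}+A_{x,y}B_{y,z}A_{x\underline{\rhd}y,z\overline{\rhd}y}+\delta B_{x,y}B_{y,z}A_{x\underline{\rhd}y,z\overline{\rhd}y}+B_{x,y}B_{y,z}B_{x\underline{\rhd}y,z\overline{\rhd}y}.$$ **The group $G$.** Put $q_{x,y}=-A_{x,y}^{-1}B_{x,y}$, $q=q_{x_0,x_0}$, and $G=\langle q_{x,y}^{-1}q: x,y\in X\rangle\le R^\times$. **Biquandle 2-cocycles.** For an abelian group $K$ (written multiplicatively), a function $\phi:X\times X\to K$ is a biquandle 2-cocycle if for all $x,y,z\in X$: $\phi(x,x)=1$ and $$\phi(x,y)\,\phi(y,z)\,\phi(x\underline{\rhd}y,z\overline{\rhd}y)=\phi(x,z)\,\phi(y\overline{\rhd}x,z\overline{\rhd}x)\,\phi(x\underline{\rhd}z,y\underline{\rhd}z).$$ *)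

(* Defs.v *)
From HB Require Import structures.
From mathcomp Require Import all_boot all_order all_algebra.
From mathcomp Require Import generic_quotient boolp classical_sets.

Set Implicit Arguments.
Unset Strict Implicit.
Unset Printing Implicit Defensive.

Import GRing.Theory.

HB.mixin Record Group_isAbelian G of Group G := {
  abmulgC : forall x y : G, (x * y = y * x)%g
}.

#[short(type="abelGroupType")]
HB.structure Definition AbelGroup := {G of Group G & Group_isAbelian G}.

Section QuotientGroup.
Local Open Scope group_scope.
Variable K : abelGroupType.
Implicit Types (H S : set K) (x y z : K).

Record subgroup_set H : Prop := SubgroupSet {
  subgroup_set1 : H 1;
  subgroup_setF : forall x y, H x -> H y -> H (x / y)
}.

Definition generated_subgroup S : set K := smallest subgroup_set S.

Lemma generated_subgroupP S : subgroup_set (generated_subgroup S).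
Proof.
split=> [H [[H1 _] _] // | x y Hx Hy H HS].
by case: (HS) => -[_ HF] _; apply: HF; [apply: Hx | apply: Hy].
Qed.

Variable S : set K.

Let G := generated_subgroup S.

Lemma generated_subgroup1 : G 1.
Proof. exact: subgroup_set1 (generated_subgroupP S). Qed.

Lemma generated_subgroupV x : G x -> G x^-1.
Proof.
rewrite -[x^-1]div1g => Gx.
exact: subgroup_setF (generated_subgroupP S) _ _ generated_subgroup1 Gx.
Qed.

Lemma generated_subgroupM x y : G x -> G y -> G (x * y).
Proof.
move=> Gx /generated_subgroupV Gy; rewrite -[y]invgK.
exact: subgroup_setF (generated_subgroupP S) _ _ Gx Gy.
Qed.

Definition coset_eq x y : bool := `[< G (x^-1 * y) >].

Lemma coset_eq_refl : reflexive coset_eq.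
Proof. by move=> x; apply/asboolP; rewrite mulVg; apply: generated_subgroup1. Qed.

Lemma coset_eq_sym : symmetric coset_eq.
Proof.
have H x y : coset_eq x y -> coset_eq y x.
  move=> /asboolP/generated_subgroupV Gxy; apply/asboolP.
  by rewrite invgM invgK in Gxy.
by move=> x y; apply/idP/idP; apply: H.
Qed.

Lemma coset_eq_trans : transitive coset_eq.
Proof.
move=> y x z /asboolP Gxy /asboolP Gyz; apply/asboolP.
by have := generated_subgroupM Gxy Gyz; rewrite -mulgA mulVKg.
Qed.

Canonical coset_equiv_rel :=
  EquivRel coset_eq coset_eq_refl coset_eq_sym coset_eq_trans.

Definition quot_group : Type := {eq_quot coset_equiv_rel}%qT.
HB.instance Definition _ := Choice.on quot_group.

Definition to_quot x : quot_group := (\pi_{eq_quot coset_equiv_rel} x)%qT.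

Lemma to_quotP x y : to_quot x = to_quot y <-> G (x^-1 * y).
Proof.
by split=> [/eqquotP/asboolP // | Gxy]; apply/eqquotP/asboolP.
Qed.

Definition quot_repr (a : quot_group) : K :=
  repr (a : {eq_quot coset_equiv_rel}%qT).

Lemma quot_reprK : cancel quot_repr to_quot.
Proof. exact: reprK. Qed.

Definition quot_one : quot_group := to_quot 1.
Definition quot_inv (a : quot_group) : quot_group := to_quot (quot_repr a)^-1.
Definition quot_mul (a b : quot_group) : quot_group :=
  to_quot (quot_repr a * quot_repr b).

Lemma quot_invE x : quot_inv (to_quot x) = to_quot x^-1.
Proof.
apply/to_quotP; rewrite invgK abmulgC.
by apply/to_quotP; rewrite quot_reprK.
Qed.

Lemma quot_mulE x y : quot_mul (to_quot x) (to_quot y) = to_quot (x * y).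
Proof.
have qx := quot_reprK (to_quot x); have qy := quot_reprK (to_quot y).
move/to_quotP: qx => qx; move/to_quotP: qy => qy; apply/to_quotP.
set x' := quot_repr _ in qx *; set y' := quot_repr _ in qy *.
have -> : (x' * y')^-1 * (x * y) = (x'^-1 * x) * (y'^-1 * y).
  rewrite invgM -!mulgA abmulgC -!mulgA; congr (_ * _); congr (_ * _).
  exact: abmulgC.
exact: generated_subgroupM.
Qed.

Lemma quot_ind (P : quot_group -> Prop) :
  (forall x, P (to_quot x)) -> forall a, P a.
Proof. by move=> Px a; rewrite -[a]quot_reprK. Qed.

Lemma quot_mulC : commutative quot_mul.
Proof. by move=> a b; rewrite /quot_mul abmulgC. Qed.

Lemma quot_mulA : associative quot_mul.
Proof.
elim/quot_ind=> x; elim/quot_ind=> y; elim/quot_ind=> z.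
by rewrite !quot_mulE mulgA.
Qed.

Lemma quot_mul1 : left_id quot_one quot_mul.
Proof. by elim/quot_ind=> x; rewrite quot_mulE mul1g. Qed.

Lemma quot_mulV : left_inverse quot_one quot_inv quot_mul.
Proof. by elim/quot_ind=> x; rewrite quot_invE quot_mulE mulVg. Qed.

Lemma quot_mul1r : right_id quot_one quot_mul.
Proof. by move=> a; rewrite quot_mulC quot_mul1. Qed.

Lemma quot_mulVr : right_inverse quot_one quot_inv quot_mul.
Proof. by move=> a; rewrite quot_mulC quot_mulV. Qed.

HB.instance Definition _ := isGroup.Build quot_group
  quot_mulA quot_mul1 quot_mul1r quot_mulV quot_mulVr.
HB.instance Definition _ := Group_isAbelian.Build quot_group quot_mulC.

Lemma to_quotM x y : to_quot (x * y) = to_quot x * to_quot y.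
Proof. by rewrite -quot_mulE. Qed.

End QuotientGroup.

Section UnitGroup.
Local Open Scope ring_scope.
Variable R : comUnitRingType.

Record units := Unit { uval :> R; uvalP : uval \is a GRing.unit }.

HB.instance Definition _ := [isSub for uval].
HB.instance Definition _ := [Choice of units by <:].

Definition units_one : units := Unit (unitr1 R).
Definition units_inv (u : units) : units :=
  @Unit (uval u)^-1 (etrans (unitrV _) (uvalP u)).
Fact units_mul_subproof (u v : units) : uval u * uval v \is a GRing.unit.
Proof. by rewrite unitrM !uvalP. Qed.
Definition units_mul (u v : units) : units := Unit (units_mul_subproof u v).
Definition units_opp (u : units) : units :=
  @Unit (- uval u) (etrans (unitrN _) (uvalP u)).

Lemma units_mulC : commutative units_mul.
Proof. by move=> u v; apply/val_inj/mulrC. Qed.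
Lemma units_mulA : associative units_mul.
Proof. by move=> u v w; apply/val_inj/mulrA. Qed.
Lemma units_mul1 : left_id units_one units_mul.
Proof. by move=> u; apply/val_inj/mul1r. Qed.
Lemma units_mulV : left_inverse units_one units_inv units_mul.
Proof. by move=> u; apply/val_inj/mulVr/uvalP. Qed.
Lemma units_mul1r : right_id units_one units_mul.
Proof. by move=> u; rewrite units_mulC units_mul1. Qed.
Lemma units_mulVr : right_inverse units_one units_inv units_mul.
Proof. by move=> u; rewrite units_mulC units_mulV. Qed.

HB.instance Definition _ := isGroup.Build units
  units_mulA units_mul1 units_mul1r units_mulV units_mulVr.
HB.instance Definition _ := Group_isAbelian.Build units units_mulC.

Lemma uvalM (u v : units) : uval (u * v)%g = uval u * uval v.
Proof. by []. Qed.
Lemma uvalV (u : units) : uval (u^-1)%g = (uval u)^-1.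
Proof. by []. Qed.

End UnitGroup.

(* [under x y] and [over x y] are the operations with an underlined, resp.
   overlined, triangle. *)
Record biquandle := Biquandle {
  bq_sort :> Type;
  under : bq_sort -> bq_sort -> bq_sort;
  over : bq_sort -> bq_sort -> bq_sort;
  bq_diag : forall x, under x x = over x x;
  bq_over_bij : forall y, bijective (fun x => over x y);
  bq_under_bij : forall y, bijective (fun x => under x y);
  bq_side_bij :
    bijective (fun p : bq_sort * bq_sort => (over p.2 p.1, under p.1 p.2));
  bq_exch_uu : forall x y z,
    under (under x y) (under z y) = under (under x z) (over y z);
  bq_exch_uo : forall x y z,
    over (under x y) (under z y) = under (over x z) (over y z);
  bq_exch_oo : forall x y z,
    over (over x y) (over z y) = over (over x z) (under y z)
}.

Arguments under {b} _ _.
Arguments over {b} _ _.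

Notation "x '\under' y" := (under x y) (at level 40, left associativity).
Notation "x '\over' y" := (over x y) (at level 40, left associativity).

Definition biquandle_2cocycle (X : biquandle) (K : abelGroupType)
    (phi : X -> X -> K) : Prop :=
  (forall x, phi x x = 1%g) /\
  (forall x y z,
     phi x y * phi y z * phi (x \under y) (z \over y)
     = phi x z * phi (y \over x) (z \over x) * phi (x \under z) (y \under z))%g.

Section BracketAxioms.
Local Open Scope ring_scope.
Variables (X : biquandle) (R : comUnitRingType).
Variables (A B : X -> X -> units R) (delta : R) (w : units R).
Local Notation a x y := (uval (A x y)).
Local Notation b x y := (uval (B x y)).

Record bracket_axioms : Prop := BracketAxioms {
  bracket_w : forall x, uval w = - (a x x) ^+ 2 * (b x x)^-1;
  bracket_delta : forall x y,
    delta = - (a x y * (b x y)^-1) - (a x y)^-1 * b x y;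
  bracket_AAA : forall x y z,
    a x y * a y z * a (x \under y) (z \over y)
    = a x z * a (y \over x) (z \over x) * a (x \under z) (y \under z);
  bracket_ABB : forall x y z,
    a x y * b y z * b (x \under y) (z \over y)
    = b x z * b (y \over x) (z \over x) * a (x \under z) (y \under z);
  bracket_BAB : forall x y z,
    b x y * a y z * b (x \under y) (z \over y)
    = b x z * a (y \over x) (z \over x) * b (x \under z) (y \under z);
  bracket_AAB : forall x y z,
    a x y * a y z * b (x \under y) (z \over y)
    = a x z * b (y \over x) (z \over x) * a (x \under z) (y \under z)
    + a x z * a (y \over x) (z \over x) * b (x \under z) (y \under z)
    + delta * a x z * b (y \over x) (z \over x) * b (x \under z) (y \under z)
    + b x z * b (y \over x) (z \over x) * b (x \under z) (y \under z);
  bracket_BAA : forall x y z,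
    b x z * a (y \over x) (z \over x) * a (x \under z) (y \under z)
    = b x y * a y z * a (x \under y) (z \over y)
    + a x y * b y z * a (x \under y) (z \over y)
    + delta * b x y * b y z * a (x \under y) (z \over y)
    + b x y * b y z * b (x \under y) (z \over y)
}.

End BracketAxioms.

Record bracket (X : biquandle) (R : comUnitRingType) := Bracket {
  brA : X -> X -> units R;
  brB : X -> X -> units R;
  br_delta : R;
  br_w : units R;
  br_axioms : bracket_axioms brA brB br_delta br_w
}.

(* A diagram is given by its semiarcs, labelled by natural numbers, and its
   crossings.  A crossing records its sign ([true] for positive) and the labels
   of the four semiarcs at it: incoming and outgoing under-semiarc, incoming and
   outgoing over-semiarc. *)
Record crossing := Crossing {
  positive : bool;
  u_in : nat; u_out : nat;
  o_in : nat; o_out : nat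
}.

Definition crossing_tuple (c : crossing) :=
  (positive c, u_in c, u_out c, o_in c, o_out c).
Definition tuple_crossing (t : bool * nat * nat * nat * nat) :=
  let: (s, ui, uo, oi, oo) := t in Crossing s ui uo oi oo.
Lemma crossing_tupleK : cancel crossing_tuple tuple_crossing.
Proof. by case. Qed.
HB.instance Definition _ := Equality.copy crossing (can_type crossing_tupleK).

(* [circles] lists the components without crossings; such a component is a
   single closed semiarc. *)
Record code := Code { crossings : seq crossing; circles : seq nat }.

Definition in_labels (C : code) : seq nat :=
  flatten [seq [:: u_in c; o_in c] | c <- crossings C].
Definition out_labels (C : code) : seq nat :=
  flatten [seq [:: u_out c; o_out c] | c <- crossings C].
Definition semiarcs (C : code) : seq nat := in_labels C ++ circles C.

(* Every semiarc that is not a circle starts at exactly one crossing and ends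
   at exactly one crossing. *)
Definition well_formed (C : code) : bool :=
  uniq (semiarcs C) && perm_eq (in_labels C) (out_labels C).

(* The four ends of semiarcs at a crossing are indexed by pairs
   (is it on the over-strand?, is it outgoing?). *)
Definition port : Type := (bool * bool)%type.

Definition port_label (c : crossing) (p : port) : nat :=
  match p with
  | (false, false) => u_in c
  | (false, true) => u_out c
  | (true, false) => o_in c
  | (true, true) => o_out c
  end.

(* The counterclockwise cyclic order of the ports around a crossing. With both
   strands pointing down, the lists start at the top left. *)
Definition ccw_ports (s : bool) : seq port :=
  if s then [:: (false, false); (true, true); (false, true); (true, false)]
  else [:: (true, false); (false, true); (true, true); (false, false)].

Section Planarity.
Variable cs : seq crossing.

Let cr (i : 'I_(size cs)) : crossing := tnth (in_tuple cs) i.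
Let dart : finType := ('I_(size cs) * port)%type.

Definition opposite_ends (d e : dart) : bool :=
  (port_label (cr d.1) d.2 == port_label (cr e.1) e.2) && (d.2.2 != e.2.2).

(* [e] is obtained from [d] by following the semiarc of [d] to its other end
   and moving on to the counterclockwise next end at that crossing. The orbits
   of this permutation of the ends are the boundaries of the faces. *)
Definition face_step (d e : dart) : bool :=
  opposite_ends d (e.1, prev (ccw_ports (positive (cr e.1))) e.2).

Definition adjacent (i j : 'I_(size cs)) : bool :=
  [exists p : port, exists p' : port,
    port_label (cr i) p == port_label (cr j) p'].

(* The 4-valent graph with vertices the n crossings and 2n edges, embedded by
   the cyclic orders above, has genus zero on every connected component, i.e.
   V - E + F equals twice the number of components. *)
Definition planar_crossings : bool :=
  n_comp face_step predT == size cs + 2 * n_comp adjacent predT.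

End Planarity.

Record link_diagram := LinkDiagram {
  diag_code :> code;
  diag_wf : well_formed diag_code;
  diag_planar : planar_crossings (crossings diag_code)
}.

Section Coloring.
Variable X : biquandle.

(* The semiarcs on the left when both strands of the crossing point down. *)
Definition left_under (c : crossing) : nat :=
  if positive c then u_in c else u_out c.
Definition right_under (c : crossing) : nat :=
  if positive c then u_out c else u_in c.
Definition left_over (c : crossing) : nat :=
  if positive c then o_out c else o_in c.
Definition right_over (c : crossing) : nat :=
  if positive c then o_in c else o_out c.

Definition colored_crossing (f : nat -> X) (c : crossing) : Prop :=
  f (right_under c) = f (left_under c) \under f (left_over c) /\
  f (right_over c) = f (left_over c) \over f (left_under c).

(* Only the values at the semiarcs of the diagram are meaningful. *)
Record coloring (D : link_diagram) := Coloring {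
  color :> nat -> X;
  color_crossing : forall c, c \in crossings D -> colored_crossing color c
}.

End Coloring.

Definition code_perm (C C' : code) : bool :=
  perm_eq (crossings C) (crossings C') && perm_eq (circles C) (circles C').

Definition relabel_crossing (g : nat -> nat) (c : crossing) : crossing :=
  Crossing (positive c) (g (u_in c)) (g (u_out c)) (g (o_in c)) (g (o_out c)).

Definition relabel (g : nat -> nat) (C : code) : code :=
  Code [seq relabel_crossing g c | c <- crossings C]
       [seq g l | l <- circles C].

Definition add_crossings (cs : seq crossing) (C : code) : code :=
  Code (cs ++ crossings C) (circles C).

(* After crossings have been removed, joins the end of the semiarc [a] to the
   beginning of the semiarc [b]; the resulting semiarc is called [a]. It is a
   circle if [a] and [b] are the same semiarc. *)
Definition merge_label (a b l : nat) : nat := if l == b then a else l.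

Definition splice (a b : nat) (C : code) : code :=
  if a == b then Code (crossings C) (a :: circles C)
  else Code [seq relabel_crossing (merge_label a b) c | c <- crossings C]
            (circles C).

(* A strand a, m, b crossing itself, first passing over if [o]. *)
Definition kink (s o : bool) (a m b : nat) : crossing :=
  if o then Crossing s m b a m else Crossing s a m m b.

(* An over-strand a, m, b and an under-strand c, n, d which cross twice, the
   first time along the over-strand with sign [s]; the under-strand meets the
   two crossings in the same order if [parallel], else in the reverse order. *)
Definition bigon (s parallel : bool) (a m b c n d : nat) : seq crossing :=
  if parallel then [:: Crossing s c n a m; Crossing (~~ s) n d m b]
  else [:: Crossing s n d a m; Crossing (~~ s) c n m b].

(* The two semiarcs at the first or second crossing of a strand x.1.1, x.1.2,
   x.2. *)
Definition passage (first : bool) (x : nat * nat * nat) : nat * nat :=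
  if first then x.1 else (x.1.2, x.2).

Definition cross (s : bool) (o u : nat * nat) : crossing :=
  Crossing s u.1 u.2 o.1 o.2.

(* A top strand [t], a middle strand [m] and a bottom strand [b] crossing
   pairwise, with the signs [tm], [tb], [mb]. For three directed lines x, y, z
   in general position in the plane, with directions dx, dy, dz, the line x
   meets y before z iff det(dx, dy) * det(dx, dz) * Delta(x, y, z) > 0, where
   Delta is antisymmetric in the lines and changes sign when one of the lines
   is moved across the intersection of the two others. The sign of a crossing
   being that of +/- det(dx, dy), x over y, this gives the order of the
   crossings along each strand; [side] is the sign of Delta(t, m, b). *)
Definition triangle (side tm tb mb : bool) (t m b : nat * nat * nat) :
    seq crossing :=
  let t_m_first := (tm == tb) == side in
  let m_t_first := (tm == mb) == side in
  let b_t_first := (tb == mb) == side in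
  [:: cross tm (passage t_m_first t) (passage m_t_first m);
      cross tb (passage (~~ t_m_first) t) (passage b_t_first b);
      cross mb (passage (~~ m_t_first) m) (passage (~~ b_t_first) b)].

(* A move between colored diagrams; the colors of all the semiarcs meeting the
   outside of the disc of the move are preserved. *)
Inductive colored_move (X : biquandle) (D D' : link_diagram)
    (f : coloring X D) (f' : coloring X D') : Prop :=
| Move_relabel (g : nat -> nat) of
    {in semiarcs D &, injective g}
  & code_perm D' (relabel g D)
  & (forall l, l \in semiarcs D -> f' (g l) = f l)
| Move_R1 (C : code) (s o : bool) (a m b : nat) of
    code_perm D (add_crossings [:: kink s o a m b] C)
  & code_perm D' (splice a b C)
  & (forall l, l \in semiarcs D -> l != m -> f' (merge_label a b l) = f l)
| Move_R2 (C : code) (s parallel : bool) (a m b c n d : nat) of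
    code_perm D (add_crossings (bigon s parallel a m b c n d) C)
  & code_perm D' (splice (merge_label a b c) d (splice a b C))
  & (forall l, l \in semiarcs D -> l \notin [:: m; n] ->
       f' (merge_label (merge_label a b c) d (merge_label a b l)) = f l)
| Move_R3 (C : code) (tm tb mb : bool)
    (t0 t1 t1' t2 m0 m1 m1' m2 b0 b1 b1' b2 : nat) of
    code_perm D (add_crossings
      (triangle true tm tb mb (t0, t1, t2) (m0, m1, m2) (b0, b1, b2)) C)
  & code_perm D' (add_crossings
      (triangle false tm tb mb (t0, t1', t2) (m0, m1', m2) (b0, b1', b2)) C)
  & (forall l, l \in semiarcs D -> l \notin [:: t1; m1; b1] -> f' l = f l).

Definition reidemeister (X : biquandle) (D D' : link_diagram)
    (f : coloring X D) (f' : coloring X D') : Prop :=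
  colored_move f f' \/ colored_move f' f.

Section Invariant.
Local Open Scope group_scope.
Variables (X : biquandle) (x0 : X) (R : comUnitRingType) (beta : bracket X R).
Local Notation A := (brA beta).
Local Notation B := (brB beta).

Definition br_q (x y : X) : units R := units_opp ((A x y)^-1 * B x y).

Definition br_gens : set (units R) :=
  [set (br_q p.1 p.2)^-1 * br_q x0 x0 | p in [set: X * X]]%classic.

Definition units_mod_G : abelGroupType := quot_group br_gens.

Definition Z_beta (D : link_diagram) (f : coloring X D) : units_mod_G :=
  to_quot br_gens (
    (\prod_(c <- crossings D | positive c)
       (A (f (left_under c)) (f (left_over c)) * (A x0 x0)^-1)) *
    (\prod_(c <- crossings D | ~~ positive c)
       ((B (f (left_under c)) (f (left_over c)))^-1 * B x0 x0))).

End Invariant.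

Definition cocycle_invariant (X : biquandle) (K : abelGroupType)
    (phi : X -> X -> K) (D : link_diagram) (f : coloring X D) : K :=
  (\prod_(c <- crossings D)
     (let v := phi (f (left_under c)) (f (left_over c)) in
      if positive c then v else v^-1))%g.

(* Main.v *)
Require Import Defs.
From mathcomp Require Import all_boot all_order all_algebra.
From HB Require Import structures.

Set Implicit Arguments.
Unset Strict Implicit.
Unset Printing Implicit Defensive.

(** The cocycle is the class [phi] of [A x y / A x0 x0] modulo [G].  In
    [R^x / G] all the quotients [B x y / A x y] have the same class, because
    [q x y] and [q x0 x0] do; so the factor [B x0 x0 / B x y] of a negative
    crossing is the inverse of [phi x y], and [Z_beta] is the state sum of
    [phi].  The cocycle condition is the bracket axiom that only involves [A],
    and [phi x x = 1] holds because [A x x ^ 2 / B x x], which is [- w], is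
    [A x x] times a quotient whose class is the same for all [x]
    ([bracket_cocycleP], [Z_betaE]).

    It remains to see that the state sum of any 2-cocycle is invariant
    ([reidemeister_invariant]).  The crossings outside the disc of a move keep
    their signs and colors, so only the crossings in the disc matter.

    In the first move the crossing has weight [phi x x] or its inverse, since
    [x \under y = y \over x] forces [x = y].  In the second move the two
    crossings have the same colors and opposite signs.

    The third move comes in eight versions, according to the signs of the
    crossings.  They are treated together.  A semiarc on one of three strands
    that cross pairwise lies on the left or on the right of each of the two
    other strands, as seen when the two strands concerned are drawn pointing
    down, so there are twelve possible semiarcs; they are the edges of
    a cube, in three parallel classes, one for each strand.  Its six faces are
    the crossings: two strands can cross on the left or on the right of the
    third one.  Elements [x, y, z] on the three edges at one vertex determine
    colors of all the edges, and the exchange laws say that these colors fit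
    together.  One side of a third move shows the three faces at some vertex of
    the cube and the other side shows the three opposite faces, the six
    semiarcs that leave the disc being the hexagon between them.  Any coloring
    of three faces at a vertex extends to the cube ([half_cube_extends]) and
    the hexagon determines [x, y, z] ([hexagon_inj]), so both sides of the move
    are parts of one colored cube ([flip_cube]).  The cocycle condition equates
    the products of the weights on two opposite halves of the cube; passing to
    another pair of opposite halves moves weights from one member of the
    equation to the other, which is what the signs of the crossings require
    ([cube_weight_flip]). *)

Local Open Scope group_scope.

HB.instance Definition _ (K : abelGroupType) :=
  SemiGroup.isCommutativeLaw.Build K *%g (@abmulgC K).

(** * Biquandles *)

Section BiquandleFacts.
Variable X : biquandle.
Implicit Types x y z : X.

Lemma over_inj y : injective (fun x : X => x \over y).
Proof. exact: bij_inj (bq_over_bij y). Qed.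

Lemma under_inj y : injective (fun x : X => x \under y).
Proof. exact: bij_inj (bq_under_bij y). Qed.

Lemma over_surj y u : exists x, u = x \over y.
Proof. by have [g _ gK] := bq_over_bij y; exists (g u); rewrite gK. Qed.

Lemma under_surj y u : exists x, u = x \under y.
Proof. by have [g _ gK] := bq_under_bij y; exists (g u); rewrite gK. Qed.

(** The map [S] of the axioms takes the left colors at a crossing to the right
    ones; by [side_inj] and [side_surj] a crossing can be read from its right
    side. *)
Lemma side_inj x y x' y' :
  y \over x = y' \over x' -> x \under y = x' \under y' -> x = x' /\ y = y'.
Proof.
move=> eo eu; suff [-> ->] : (x, y) = (x', y') by [].
by apply: (bij_inj (bq_side_bij X)); rewrite /= eo eu.
Qed.

Lemma side_surj u v : exists x y, u = y \over x /\ v = x \under y.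
Proof.
have [g _ gK] := bq_side_bij X; exists (g (u, v)).1, (g (u, v)).2.
by have := gK (u, v) => /= -[-> ->].
Qed.

(** The exchange law at [x, y, x] forces [x \under y = x \under x]; the
    latter is [x \over x], so that [x] and [y] have the same image under
    [\over x]. *)
Lemma under_eq_over x y : x \under y = y \over x -> x = y.
Proof.
move=> xy; have m_eq : x \under y = x \under x.
  by have := bq_exch_uu x y x; rewrite -xy => /under_inj.
by apply: (@over_inj x); rewrite /= -xy m_eq bq_diag.
Qed.

End BiquandleFacts.

(** * The cube of colors of three strands *)

Section Cube.
Variable X : biquandle.
Implicit Types (x y z : X) (b m t : bool -> bool -> X).

(** The edges of the cube. The two booleans tell whether the semiarc is on the
    right of each of the two other strands, called [m], [b] and [t] for the
    middle, bottom and top ones. At [true, true] one of the two equal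
    expressions given by the exchange laws is chosen. *)
Definition bottom_edge x y z (rm rt : bool) : X :=
  match rm, rt with
  | false, false => x
  | true, false => x \under y
  | false, true => x \under z
  | true, true => (x \under y) \under (z \over y)
  end.

Definition middle_edge x y z (rb rt : bool) : X :=
  match rb, rt with
  | false, false => y
  | true, false => y \over x
  | false, true => y \under z
  | true, true => (y \over x) \under (z \over x)
  end.

Definition top_edge x y z (rm rb : bool) : X :=
  match rm, rb with
  | false, false => z
  | true, false => z \over y
  | false, true => z \over x
  | true, true => (z \over y) \over (x \under y)
  end.

(** A coloring of a face: left and right semiarcs of the under-strand, then of
    the over-strand. *)
Definition square (ul ur ol or : X) : Prop :=
  ur = ul \under ol /\ or = ol \over ul.

(** The faces at a vertex: the middle and bottom strands cross on the side [k]
    of the top strand, the top and middle ones on the side [j] of the bottom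
    strand, the top and bottom ones on the side [i] of the middle strand. One
    of the four edges on each strand is on none of these faces, and the value
    of [b], [m] or [t] there is irrelevant. *)
Definition half_cube (k j i : bool) b m t : Prop :=
  [/\ square (m j false) (m j true) (t false j) (t true j),
      square (b i false) (b i true) (t i false) (t i true)
    & square (b false k) (b true k) (m false k) (m true k)].

Definition in_cube (k j i : bool) b m t x y z : Prop :=
  forall r, [/\ b r k = bottom_edge x y z r k, b i r = bottom_edge x y z i r,
    m r k = middle_edge x y z r k, m j r = middle_edge x y z j r &
    t r j = top_edge x y z r j /\ t i r = top_edge x y z i r].

Local Ltac fill_cube x y z := exists x, y, z;
  have := bq_exch_uu x z y; have := bq_exch_uo y z x;
  have := bq_exch_oo z x y; move=> oo uo uu;
  case; split; try split; rewrite /=; congruence.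

(** When at least two of the faces are on left sides, [x], [y] and [z] are
    colors of edges of these faces. When only one is, two of them are, and the
    third one is obtained by inverting a translation. When none is, [x] and [z]
    come from inverting [S]. The remaining edge colors follow by cancelling in
    an exchange law. *)
Lemma half_cube_extends k j i b m t :
  half_cube k j i b m t -> exists x y z, in_cube k j i b m t x y z.
Proof.
move=> [[mu to] [bu to'] [bu' mo]].
move: k j i mu to bu to' bu' mo => [] [] [] mu to bu to' bu' mo.
- have [x [z [tLR bLR]]] := side_surj (t false true) (b false true).
  have [y mLR] := under_surj z (m false true).
  have mRL : m true false = y \over x.
    apply: (@under_inj _ (z \over x)).
    by rewrite -tLR -mu mo mLR bLR bq_exch_uo tLR.
  have [bRL tRL] : b true false = x \under y /\ t true false = z \over y.
    apply: side_inj.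
      by rewrite -to' to tLR mRL bq_exch_oo.
    by rewrite -bu bu' bLR mLR bq_exch_uu.
  fill_cube x y z.
- have [y mRL] := over_surj (b false false) (m true false).
  have mLR : m false true = y \under t false false.
    apply: (@over_inj _ (b false false \under t false false)).
    by rewrite /= bq_exch_uo -bu -mo mu mRL to'.
  fill_cube (b false false) y (t false false).
- have [x bLR] := under_surj (t false false) (b false true).
  have bRL : b true false = x \under m false false.
    apply: (@under_inj _ (t false false \over m false false)).
    by rewrite /= -bq_exch_uu -to -bu bu' bLR mu.
  fill_cube x (m false false) (t false false).
- fill_cube (b false false) (m false false) (t false false).
- have [z tRL] := over_surj (m false false) (t true false).
  have tLR : t false true = z \over b false false.
    apply: (@over_inj _ (m false false \over b false false)).
    by rewrite /= bq_exch_oo -mo -to to' tRL bu'.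
  fill_cube (b false false) (m false false) z.
- fill_cube (b false false) (m false false) (t false false).
- fill_cube (b false false) (m false false) (t false false).
- fill_cube (b false false) (m false false) (t false false).
Qed.

(** On each strand, the edge that lies on two of the faces [k, j, i] is inside
    the disc of the move, the edge that lies on none belongs to the opposite
    vertex, and the two others leave the disc. *)
Definition same_hexagon (k j i : bool) b m t b' m' t' : Prop :=
  [/\ b i (~~ k) = b' i (~~ k) /\ b (~~ i) k = b' (~~ i) k,
      m j (~~ k) = m' j (~~ k) /\ m (~~ j) k = m' (~~ j) k
    & t i (~~ j) = t' i (~~ j) /\ t (~~ i) j = t' (~~ i) j].

(** Either two of [x], [y], [z] are on the hexagon, and the third one is found
    by cancelling a translation; or both right colors of the crossing of [x]
    and [z] are, and [S] is injective. *)
Lemma hexagon_inj k j i x y z x' y' z' :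
  same_hexagon k j i (bottom_edge x y z) (middle_edge x y z) (top_edge x y z)
    (bottom_edge x' y' z') (middle_edge x' y' z') (top_edge x' y' z') ->
  [/\ x = x', y = y' & z = z'].
Proof.
have A u v w : u \over v = w \over v -> u = w := @over_inj X v u w.
have B u v w : u \under v = w \under v -> u = w := @under_inj X v u w.
case: k j i => [] [] [] [] /= [b1 b2] [m1 m2] [t1 t2].
- have [? ?] := side_inj t2 b2; subst x' z'; split=> //; exact: (A _ x).
- subst x' z'; split=> //; exact: (A _ x).
- subst y' z'; split=> //; exact: (B _ z).
- subst x' y'; split=> //; exact: (A _ x).
- subst x' y'; split=> //; exact: (A _ x).
- subst y' z'; split=> //; exact: (B _ z).
- subst x' z'; split=> //; exact: (A _ x).
- have [? ?] := side_inj t1 b1; subst x' z'; split=> //; exact: (A _ x).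
Qed.

(** The two sides of a third move sit at opposite vertices of one cube. *)
Lemma flip_cube k j i b m t b' m' t' :
  half_cube k j i b m t -> half_cube (~~ k) (~~ j) (~~ i) b' m' t' ->
  same_hexagon k j i b m t b' m' t' ->
  exists x y z, in_cube k j i b m t x y z /\
    in_cube (~~ k) (~~ j) (~~ i) b' m' t' x y z.
Proof.
move=> /half_cube_extends [x [y [z H]]] /half_cube_extends [x' [y' [z' H']]].
move=> hex; suff [? ? ?] : [/\ x = x', y = y' & z = z'].
  by subst x' y' z'; exists x, y, z.
apply: (@hexagon_inj k j i).
case: hex => -[b1 b2] [m1 m2] [t1 t2].
have [_ B1 _ M1 [_ T1]] := H (~~ k); have [B2 _ M2 _ [T2 _]] := H (~~ i).
have [_ B1' _ M1' [_ T1']] := H' k; have [B2' _ M2' _ [T2' _]] := H' i.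
have [_ _ M3 _ [_ T3]] := H (~~ j).
have [_ _ M3' _ [_ T3']] := H' j.
split; split; congruence.
Qed.

Variables (K : abelGroupType) (phi : X -> X -> K).
Hypothesis phi_cocycle : biquandle_2cocycle phi.

Definition signed (s : bool) (v : K) : K := if s then v else v^-1.

(** The factor between the contributions of two opposite faces does not depend
    on the sign [s]: changing [s] exchanges the two faces and inverts the
    weights, and the two effects compensate. *)
Lemma signed_neg (s : bool) (W : bool -> K) :
  signed s (W (~~ s)) = W false / W true * signed s (W s).
Proof.
by case: s => /=; [rewrite mulgVK | rewrite abmulgC mulKg].
Qed.

Definition half_weight (tm tb mb k j i : bool) b m t : K :=
  signed tm (phi (m j false) (t false j)) *
  (signed tb (phi (b i false) (t i false)) *
   signed mb (phi (b false k) (m false k))).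

(** By [signed_neg] a flip multiplies the contribution of each crossing, or
    divides it for the crossing of the top and bottom strands, by the quotient
    of the weights of two opposite faces. The cocycle condition says that the
    quotients of the two other pairs multiply to that of the pair of the top
    and bottom strands. *)
Lemma cube_weight_flip (tm tb mb : bool) x y z :
  let b := bottom_edge x y z in
  let m := middle_edge x y z in
  let t := top_edge x y z in
  half_weight tm tb mb mb tm (~~ tb) b m t
  = half_weight tm tb mb (~~ mb) (~~ tm) tb b m t.
Proof.
move=> b m t; rewrite /half_weight.
pose Wm j := phi (m j false) (t false j).
pose Wt i := phi (b i false) (t i false).
pose Wb k := phi (b false k) (m false k).
rewrite -[phi (m tm _) _]/(Wm tm) -[phi (m (~~ tm) _) _]/(Wm (~~ tm)).
rewrite -[phi (b tb _) _]/(Wt tb) -[phi (b (~~ tb) _) _]/(Wt (~~ tb)).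
rewrite -[phi _ (m _ mb)]/(Wb mb) -[phi _ (m _ (~~ mb))]/(Wb (~~ mb)).
have W : Wb false * Wm false * Wt true = Wt false * Wm true * Wb true.
  exact: phi_cocycle.2.
rewrite !signed_neg.
have -> : Wt false / Wt true = Wm false / Wm true * (Wb false / Wb true).
  apply: (@mulIg _ (Wt true)); rewrite mulgVK.
  apply: (@mulIg _ (Wm true * Wb true)); rewrite mulgA -W.
  rewrite [RHS](AC ((2*2)*1*2) ((3*1*5)*((2*6)*(4*7)))%AC) /=.
  by rewrite !mulVg !mulg1.
set p := Wm false / _; set q := Wb false / _.
by rewrite [RHS](AC (2*(1*2)) (2*((1*4)*3*5))%AC).
Qed.

End Cube.

(** * Invariance of the state sum of a cocycle *)

Section CocycleInvariant.
Variables (X : biquandle) (K : abelGroupType) (phi : X -> X -> K).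
Hypothesis phi_cocycle : biquandle_2cocycle phi.
Implicit Types (f : nat -> X) (c : crossing) (cs : seq crossing).

Definition weight f c : K :=
  signed (positive c) (phi (f (left_under c)) (f (left_over c))).

Lemma cocycle_invariantE D (f : coloring X D) :
  cocycle_invariant phi f = \prod_(c <- crossings D) weight f c.
Proof. by []. Qed.

Lemma weight_relabel f f' g c :
  (forall p, f' (g (port_label c p)) = f (port_label c p)) ->
  weight f' (relabel_crossing g c) = weight f c.
Proof.
move=> H; rewrite /weight /left_under /left_over.
case: c H => -[] ui uo oi oo /= H.
  by rewrite (H (false, false)) (H (true, true)).
by rewrite (H (false, true)) (H (true, false)).
Qed.

Lemma weights_relabel f f' g cs :
  (forall c, c \in cs ->
     forall p, f' (g (port_label c p)) = f (port_label c p)) ->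
  \prod_(c <- [seq relabel_crossing g c | c <- cs]) weight f' c
  = \prod_(c <- cs) weight f c.
Proof.
move=> H; rewrite big_map; apply: eq_big_seq => c cs_c.
exact/weight_relabel/H.
Qed.

Lemma port_semiarc (D : link_diagram) c p :
  c \in crossings D -> port_label c p \in semiarcs D.
Proof.
move=> Dc; have /andP[_ io] := diag_wf D.
rewrite mem_cat; apply/orP; left.
have in_ins l : l \in [:: u_in c; o_in c] -> l \in in_labels D.
  by move=> lc; apply/flatten_mapP; exists c.
have in_outs l : l \in [:: u_out c; o_out c] -> l \in in_labels D.
  by move=> lc; rewrite (perm_mem io); apply/flatten_mapP; exists c.
by case: p => [[] []]; [apply: in_outs | apply: in_ins | apply: in_outs
  | apply: in_ins]; rewrite !inE eqxx ?orbT.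
Qed.

Lemma labels_uniq (D : link_diagram) cs cs' :
  perm_eq (crossings D) (cs ++ cs') ->
  uniq (in_labels (Code (cs ++ cs') [::])) /\
  uniq (out_labels (Code (cs ++ cs') [::])).
Proof.
move=> Dp; have /andP[u io] := diag_wf D.
have {}u : uniq (in_labels D) by move: u; rewrite cat_uniq => /and3P[].
have uo : uniq (out_labels D) by rewrite -(perm_uniq io).
by split; [move: u | move: uo];
  rewrite (perm_uniq (perm_flatten (perm_map _ Dp))).
Qed.

(** A semiarc that both begins and ends in the disc of a move does not meet
    the outside of the disc, as each label occurs once as a beginning and once
    as an end. *)
Lemma inner_label (D : link_diagram) cs cs' l c p :
  perm_eq (crossings D) (cs ++ cs') ->
  l \in in_labels (Code cs [::]) -> l \in out_labels (Code cs [::]) ->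
  c \in cs' -> port_label c p != l.
Proof.
move=> Dp l_in l_out c_cs'; have [] := labels_uniq Dp.
rewrite /in_labels /out_labels /= !map_cat !flatten_cat !cat_uniq.
move=> /and3P[_ /hasPn ui _] /and3P[_ /hasPn uo _].
apply/eqP => lc.
have [p_out|p_in] := boolP p.2; [have := uo l | have := ui l];
    rewrite ?l_in ?l_out => H.
  suff /H : l \in flatten [seq [:: u_out c; o_out c] | c <- cs'] by [].
  apply/flatten_mapP; exists c => //.
  by case: p p_out lc => [] [] [] //= _ <-; rewrite !inE eqxx ?orbT.
suff /H : l \in flatten [seq [:: u_in c; o_in c] | c <- cs'] by [].
apply/flatten_mapP; exists c => //.
by case: p p_in lc => [] [] [] //= _ <-; rewrite !inE eqxx ?orbT.
Qed.

Lemma splice_weights f f' a b (C : code) :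
  (forall c, c \in crossings C ->
     forall p, f' (merge_label a b (port_label c p)) = f (port_label c p)) ->
  \prod_(c <- crossings (splice a b C)) weight f' c
  = \prod_(c <- crossings C) weight f c.
Proof.
rewrite /splice; case: eqP => [-> H | _]; last exact: weights_relabel.
apply: eq_big_seq => c Cc; rewrite -[in LHS](_ : relabel_crossing id c = c).
  apply: weight_relabel => p; rewrite -H // /merge_label.
  by case: eqP => [->|].
by case: c {Cc}.
Qed.

Lemma kink_weight f s o a m b :
  colored_crossing f (kink s o a m b) -> weight f (kink s o a m b) = 1.
Proof.
rewrite /weight /colored_crossing.
rewrite /left_under /left_over /right_under /right_over.
suff phi1 x y : x = y -> signed s (phi x y) = 1.
  case: s o phi1 => [] [] phi1 /= [eu eo]; apply: phi1 => //;
    apply: under_eq_over; congruence.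
by move=> ->; rewrite (phi_cocycle.1); case: s => //=; rewrite invg1.
Qed.

Lemma bigon_weight f s par (a m b d n e : nat) :
  (forall x, x \in bigon s par a m b d n e -> colored_crossing f x) ->
  \prod_(x <- bigon s par a m b d n e) weight f x = 1.
Proof.
have cancel_pair x y : positive y = ~~ positive x ->
    f (left_under x) = f (left_under y) -> f (left_over x) = f (left_over y) ->
    \prod_(c <- [:: x; y]) weight f c = 1.
  rewrite big_cons big_seq1 /weight => -> -> ->.
  by case: (positive x) => /=; rewrite ?mulVg ?mulgV.
case: par => H; apply: cancel_pair => //;
  have [] := H _ (mem_head _ _); have [] := H _ (mem_last _ _);
  case: s {H}; rewrite /left_under /left_over /right_under /right_over /=;
  move=> ? ? ? ? //.
- apply: (@under_inj _ (f m)) => /=; congruence.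
- apply: (@over_inj _ (f n)) => /=; congruence.
- by have [] : f e = f d /\ f a = f b by apply: side_inj; congruence.
- by have [] : f e = f d /\ f a = f b by apply: side_inj; congruence.
Qed.

(** The color of a strand after passing both, one or none of its two
    crossings; [p] and [q] tell which ones have been passed. *)
Definition strand_color f (s : nat * nat * nat) (p q : bool) : X :=
  f (if p && q then s.2 else if p || q then s.1.2 else s.1.1).

(** A strand passing under another one at a positive crossing goes from its
    left to its right, and at a negative crossing from its right to its left;
    for the over-strand it is the reverse. So the sides on which a semiarc lies
    tell which crossings precede it. *)
Definition bottom_color f b (tb mb : bool) (rm rt : bool) :=
  strand_color f b (rm == mb) (rt == tb).
Definition middle_color f m (tm mb : bool) (rb rt : bool) :=
  strand_color f m (rb (+) mb) (rt == tm).
Definition top_color f t tm tb rm rb :=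
  strand_color f t (rm (+) tm) (rb (+) tb).

(** With the order of the crossings prescribed by [triangle], the side of the
    third strand on which two strands cross depends only on [side] and on the
    sign of that crossing: the other signs occur twice and cancel. *)
Lemma triangle_half_cube f side tm tb mb t m b :
  (forall c, c \in triangle side tm tb mb t m b -> colored_crossing f c) ->
  half_cube (~~ (mb (+) side)) (~~ (tm (+) side)) (tb (+) side)
    (bottom_color f b tb mb) (middle_color f m tm mb) (top_color f t tm tb).
Proof.
move=> H.
have {}H n : (n < 3)%N -> colored_crossing f
    (nth (Crossing true 0 0 0 0) (triangle side tm tb mb t m b) n).
  by move=> n3; apply/H/mem_nth.
split; [have [] := H 0%N isT | have [] := H 1%N isT | have [] := H 2%N isT];
  by case: side tm tb mb {H} => [] [] [] [].
Qed.

Lemma triangle_weight f side tm tb mb t m b :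
  \prod_(c <- triangle side tm tb mb t m b) weight f c
  = half_weight phi tm tb mb
      (~~ (mb (+) side)) (~~ (tm (+) side)) (tb (+) side)
      (bottom_color f b tb mb) (middle_color f m tm mb) (top_color f t tm tb).
Proof.
rewrite /triangle !big_cons big_nil mulg1.
by case: side tm tb mb => [] [] [] [].
Qed.

Lemma half_weight_in_cube tm tb mb k j i b m t x y z :
  in_cube k j i b m t x y z ->
  half_weight phi tm tb mb k j i b m t
  = half_weight phi tm tb mb k j i
      (bottom_edge x y z) (middle_edge x y z) (top_edge x y z).
Proof.
move=> /(_ false) [Eb Eb' Em Em' [Et Et']].
by rewrite /half_weight Eb Eb' Em Em' Et Et'.
Qed.

Lemma triangle_flip_weight f f' tm tb mb
    t0 t1 t1' t2 m0 m1 m1' m2 b0 b1 b1' b2 :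
  let T := triangle true tm tb mb (t0, t1, t2) (m0, m1, m2) (b0, b1, b2) in
  let T' := triangle false tm tb mb (t0, t1', t2) (m0, m1', m2) (b0, b1', b2) in
  (forall c, c \in T -> colored_crossing f c) ->
  (forall c, c \in T' -> colored_crossing f' c) ->
  (forall l, l \in [:: t0; t2; m0; m2; b0; b2] -> f' l = f l) ->
  \prod_(c <- T) weight f c = \prod_(c <- T') weight f' c.
Proof.
move=> T T' /triangle_half_cube H /triangle_half_cube H' ff'.
rewrite !triangle_weight.
move: H H'; rewrite !addbT !addbF !negbK => H H'.
have hex : same_hexagon mb tm (~~ tb)
    (bottom_color f (b0, b1, b2) tb mb) (middle_color f (m0, m1, m2) tm mb)
    (top_color f (t0, t1, t2) tm tb)
    (bottom_color f' (b0, b1', b2) tb mb) (middle_color f' (m0, m1', m2) tm mb)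
    (top_color f' (t0, t1', t2) tm tb).
  have [ft0 ft2] : f' t0 = f t0 /\ f' t2 = f t2.
    by split; apply: ff'; rewrite !inE eqxx ?orbT.
  have [fm0 fm2] : f' m0 = f m0 /\ f' m2 = f m2.
    by split; apply: ff'; rewrite !inE eqxx ?orbT.
  have [fb0 fb2] : f' b0 = f b0 /\ f' b2 = f b2.
    by split; apply: ff'; rewrite !inE eqxx ?orbT.
  by clear T T' H H'; case: tm tb mb => [] [] []; split; split.
rewrite -[X in half_cube _ _ X _ _ _](negbK tb) in H'.
have [x [y [z [E E']]]] := flip_cube H H' hex.
rewrite negbK in E'.
rewrite (half_weight_in_cube _ _ _ E) (half_weight_in_cube _ _ _ E').
exact: cube_weight_flip.
Qed.

Lemma triangle_labels side tm tb mb (t0 t1 t2 m0 m1 m2 b0 b1 b2 : nat) :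
  let T := triangle side tm tb mb (t0, t1, t2) (m0, m1, m2) (b0, b1, b2) in
  let C := Code T [::] in
  perm_eq (in_labels C) [:: t0; m0; b0; t1; m1; b1] /\
  perm_eq (out_labels C) [:: t2; m2; b2; t1; m1; b1].
Proof.
by split; apply/permP => P; case: side tm tb mb => [] [] [] [] /=;
  move: (P _) (P _) (P _) (P _) (P _) (P _) => [] [] [] [] [] [].
Qed.

(** The inner labels also are beginnings and ends at the triangle, so by
    uniqueness they differ from the labels [t0], [m0], [b0] of incoming ends
    and [t2], [m2], [b2] of outgoing ends. *)
Lemma triangle_ends (D : link_diagram) cs side tm tb mb
    (t0 t1 t2 m0 m1 m2 b0 b1 b2 l : nat) :
  perm_eq (crossings D)
    (triangle side tm tb mb (t0, t1, t2) (m0, m1, m2) (b0, b1, b2) ++ cs) ->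
  l \in [:: t0; t2; m0; m2; b0; b2] ->
  l \in semiarcs D /\ l \notin [:: t1; m1; b1].
Proof.
move=> Dp l_end.
have [tri_in tri_out] :=
  triangle_labels side tm tb mb t0 t1 t2 m0 m1 m2 b0 b1 b2.
have /andP[_ io] := diag_wf D.
have in_cat : perm_eq (in_labels D)
    ([:: t0; m0; b0; t1; m1; b1] ++ in_labels (Code cs [::])).
  apply: perm_trans (perm_flatten (perm_map _ Dp)) _.
  by rewrite map_cat flatten_cat perm_cat2r.
have out_cat : perm_eq (in_labels D)
    ([:: t2; m2; b2; t1; m1; b1] ++ out_labels (Code cs [::])).
  apply: perm_trans io _; apply: perm_trans (perm_flatten (perm_map _ Dp)) _.
  by rewrite map_cat flatten_cat perm_cat2r.
have u : uniq (in_labels D).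
  by have /andP[] := diag_wf D; rewrite cat_uniq => /andP[].
have ui := u; rewrite (perm_uniq in_cat) cat_uniq in ui.
have uo := u; rewrite (perm_uniq out_cat) cat_uniq in uo.
move: ui uo => /and3P[ui _ _] /and3P[uo _ _].
have /orP[l0|l2] : (l \in [:: t0; m0; b0]) || (l \in [:: t2; m2; b2]).
  by move: l_end; rewrite !inE; do 6 case: (l == _).
- split.
    by rewrite mem_cat (perm_mem in_cat) mem_cat (mem_cat _ [:: _; _; _]) l0.
  move: ui; rewrite (cat_uniq [:: _; _; _]) => /and3P[_ /hasPn H _].
  by apply: contraL l0 => /H.
- split.
    by rewrite mem_cat (perm_mem out_cat) mem_cat (mem_cat _ [:: _; _; _]) l2.
  move: uo; rewrite (cat_uniq [:: _; _; _]) => /and3P[_ /hasPn H _].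
  by apply: contraL l2 => /H.
Qed.

Lemma colored_move_invariant (D D' : link_diagram) (f : coloring X D)
    (f' : coloring X D') :
  colored_move f f' -> cocycle_invariant phi f = cocycle_invariant phi f'.
Proof.
rewrite !cocycle_invariantE => -[].
- move=> g _ /andP[D'p _] ff'; rewrite (perm_big _ D'p) /=; symmetry.
  by apply: weights_relabel => c Dc p; apply/ff'/port_semiarc.
- move=> C s o a m b /andP[Dp _] /andP[D'p _] ff'.
  rewrite (perm_big _ Dp) (perm_big _ D'p) /= big_cons kink_weight ?mul1g.
    symmetry; apply: splice_weights => c Cc p; apply: ff'.
      by apply: port_semiarc; rewrite (perm_mem Dp) inE Cc orbT.
    by apply: (inner_label _ Dp) => //; case: (o); rewrite !inE eqxx ?orbT.
  by apply: color_crossing; rewrite (perm_mem Dp) mem_head.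
- move=> C s par a m b c n d /andP[Dp _] /andP[D'p _] ff'.
  rewrite (perm_big _ Dp) (perm_big _ D'p) big_cat /= bigon_weight.
    rewrite mul1g; symmetry.
    rewrite (@splice_weights (f' \o merge_label (merge_label a b c) d)) //.
    apply: splice_weights => x Cx p; apply: ff'.
      by apply: port_semiarc; rewrite (perm_mem Dp) mem_cat Cx orbT.
    by rewrite !inE negb_or; apply/andP; split; apply: (inner_label _ Dp) => //;
      case: (par); rewrite !inE eqxx ?orbT.
  by move=> x big_x; apply: color_crossing; rewrite (perm_mem Dp) mem_cat big_x.
- move=> C tm tb mb t0 t1 t1' t2 m0 m1 m1' m2 b0 b1 b1' b2.
  move=> /andP[Dp _] /andP[D'p _] ff'.
  rewrite (perm_big _ Dp) (perm_big _ D'p) !big_cat /=; congr (_ * _).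
    apply: triangle_flip_weight => [c Tc | c Tc | l l_end].
    + by apply: color_crossing; rewrite (perm_mem Dp) mem_cat Tc.
    + by apply: color_crossing; rewrite (perm_mem D'p) mem_cat Tc.
    + by have [? ?] := triangle_ends Dp l_end; apply: ff'.
  (* The outside is the same on both sides: it is relabelled by [id]. *)
  symmetry; rewrite -[in LHS](map_id (crossings C)).
  have idE : (fun c => c) =1 relabel_crossing id by case.
  rewrite (eq_map idE); apply: weights_relabel => c Cc p; apply: ff'.
    by apply: port_semiarc; rewrite (perm_mem Dp) mem_cat Cc orbT.
  have [ti to] := triangle_labels true tm tb mb t0 t1 t2 m0 m1 m2 b0 b1 b2.
  by rewrite !inE !negb_or; apply/and3P; split; apply: (inner_label _ Dp) => //;
    rewrite ?(perm_mem ti) ?(perm_mem to) !inE eqxx ?orbT.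
Qed.

Lemma reidemeister_invariant (D D' : link_diagram) (f : coloring X D)
    (f' : coloring X D') :
  reidemeister f f' -> cocycle_invariant phi f = cocycle_invariant phi f'.
Proof. by case=> /colored_move_invariant. Qed.

End CocycleInvariant.

(** * The cocycle of a bracket *)

Section BracketCocycle.
Variables (X : biquandle) (x0 : X) (R : comUnitRingType) (beta : bracket X R).
Local Notation A := (brA beta).
Local Notation B := (brB beta).
Local Notation gens := (br_gens x0 beta).

Definition bracket_cocycle (x y : X) : units_mod_G x0 beta :=
  to_quot gens (A x y * (A x0 x0)^-1).

(** [G] is generated so that this ratio, which is [- q x y], has a constant
    class. *)
Lemma ratio_mod_G x y : to_quot gens ((A x y)^-1 * B x y)
  = to_quot gens ((A x0 x0)^-1 * B x0 x0).
Proof.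
apply/to_quotP => H [_]; apply; exists (x, y) => //=.
by apply/val_inj; rewrite /= GRing.invrN GRing.mulrNN.
Qed.

Lemma to_quotV x : to_quot gens x^-1 = (to_quot gens x)^-1.
Proof. by rewrite -quot_invE. Qed.

Lemma bracket_cocycleV x y :
  to_quot gens ((B x y)^-1 * B x0 x0) = (bracket_cocycle x y)^-1.
Proof.
have := ratio_mod_G x y; rewrite /bracket_cocycle !to_quotM !to_quotV.
move: (to_quot _ (A x y)) (to_quot _ (B x y)) => a b.
move: (to_quot _ (A x0 x0)) (to_quot _ (B x0 x0)) => a0 b0 E.
have -> : b0 = a0 * a^-1 * b by rewrite -mulgA E mulVKg.
by rewrite invgM invgK [LHS]abmulgC mulgK.
Qed.

(** [w] is the same for all [x], and [- w] is [A x x] divided by the ratio of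
    [ratio_mod_G], so that [A x x] has a constant class. *)
Lemma bracket_cocycle_diag x : bracket_cocycle x x = 1.
Proof.
have w_eq : A x x * A x x * (B x x)^-1 = A x0 x0 * A x0 x0 * (B x0 x0)^-1.
  have w := bracket_w (br_axioms beta).
  have := etrans (esym (w x)) (w x0).
  by rewrite !GRing.expr2 !GRing.mulNr => /GRing.oppr_inj ?; apply/val_inj.
have := congr1 (to_quot gens) w_eq; have := ratio_mod_G x x.
rewrite /bracket_cocycle !to_quotM !to_quotV.
move: (to_quot _ (A x x)) (to_quot _ (B x x)) => a b.
move: (to_quot _ (A x0 x0)) (to_quot _ (B x0 x0)) => a0 b0 E.
have divE (u v : units_mod_G x0 beta) : u * u * v^-1 = u * (u^-1 * v)^-1.
  by rewrite -mulgA invgM invgK [u / v]abmulgC.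
by rewrite !divE E => /mulIg ->; rewrite mulgV.
Qed.

Lemma bracket_cocycleP : biquandle_2cocycle bracket_cocycle.
Proof.
split=> [x | x y z]; first exact: bracket_cocycle_diag.
rewrite /bracket_cocycle.
have quot3 (u v w : units R) :
    to_quot gens u * to_quot gens v * to_quot gens w = to_quot gens (u * v * w).
  by rewrite !to_quotM.
rewrite [LHS]quot3 [RHS]quot3; congr to_quot.
have E := bracket_AAA (br_axioms beta) x y z.
set c := (A x0 x0)^-1.
have tri (u v w : units R) :
    u * c * (v * c) * (w * c) = u * v * w * (c * c * c).
  by rewrite [LHS](AC (2*2*2) ((1*3*5)*(2*4*6))%AC).
by rewrite !tri; congr (_ * _); apply/val_inj.
Qed.

Lemma Z_betaE (D : link_diagram) (f : coloring X D) :
  Z_beta x0 beta f = cocycle_invariant bracket_cocycle f.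
Proof.
rewrite /Z_beta cocycle_invariantE to_quotM.
have quot_prod (P : pred crossing) F :
    to_quot gens (\prod_(c <- crossings D | P c) F c)
    = \prod_(c <- crossings D | P c) to_quot gens (F c).
  by apply: (big_morph (to_quot gens)) => // u v; rewrite to_quotM.
rewrite !quot_prod [RHS](bigID positive) /=; congr (_ * _).
  by apply: eq_bigr => c; rewrite /weight => ->.
apply: eq_bigr => c /negbTE c_neg.
by rewrite /weight c_neg /= -bracket_cocycleV.
Qed.

End BracketCocycle.

Theorem proposition1 (X : biquandle) (x0 : X) (R : comUnitRingType)
    (beta : bracket X R) :
  (exists phi : X -> X -> units_mod_G x0 beta,
     biquandle_2cocycle phi /\
     forall (D : link_diagram) (f : coloring X D),
       Z_beta x0 beta f = cocycle_invariant phi f) /\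
  (forall (D D' : link_diagram) (f : coloring X D) (f' : coloring X D'),
     reidemeister f f' -> Z_beta x0 beta f = Z_beta x0 beta f').
Proof.
have phiP := bracket_cocycleP x0 beta.
split=> [|D D' f f' move_ff']; last first.
  by rewrite !Z_betaE; apply: reidemeister_invariant.
by exists (bracket_cocycle x0 beta); split=> // D f; apply: Z_betaE.
Qed.
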